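(* If $M$ is a graphic matroid, then $M$ is orderable.
   Context: All matroids are finite. A reversible cyclic ordering of a finite set $X$ with $|X|=n$ is an arrangement of the elements of $X$ on the vertices of an $n$-gon, one element at each vertex (considered up to rotation and reflection); two elements are adjacent in the ordering when their vertices lie on a common edge of the $n$-gon. An ordering of a matroid $M$ is a choice of a reversible cyclic ordering for each circuit of $M$. It is consistent if, for every pair $\{e,f\}$ of distinct elements of $E(M)$ and every pair $\{C,C'\}$ of circuits with $\{e,f\}\subseteq C\cap C'$, if $e$ and $f$ are adjacent in the ordering of $C$, then they are adjacent in the ordering of $C'$. A matroid is orderable if it has a consistent ordering. *)

(* Defs.v *)
From mathcomp Require Import all_boot.

Set Implicit Arguments.
Unset Strict Implicit.
Unset Printing Implicit Defensive.

(* The ground set of the matroid is the whole finite type E. *)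
Record matroid (E : finType) := Matroid {
  indep : {set {set E}};
  indep0 : set0 \in indep;
  indepS : forall A B : {set E}, A \subset B -> B \in indep -> A \in indep;
  indep_aug : forall A B : {set E}, A \in indep -> B \in indep -> #|A| < #|B| ->
    exists2 x, x \in B :\: A & x |: A \in indep
}.

Definition circuit (E : finType) (M : matroid E) (C : {set E}) : bool :=
  minset (fun X => X \notin indep M) C.

(* Loops and parallel edges are allowed. The graph is undirected: the order of
   the two components of [ends e] is ignored by [joins]. *)
Record graph := Graph {
  vertex : finType;
  edge : finType;
  ends : edge -> vertex * vertex
}.

Definition joins (G : graph) (e : edge G) (u v : vertex G) : bool :=
  (ends e == (u, v)) || (ends e == (v, u)).

(* The list (v_0, e_0), ..., (v_(k-1), e_(k-1)) stands for the closed walk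
   v_0 e_0 v_1 e_1 ... v_(k-1) e_(k-1) v_0. For k = 1 it is a loop; for k = 2
   it is a pair of parallel edges, which must be required to be distinct. *)
Definition graph_cycle (G : graph) (p : seq (vertex G * edge G)) : bool :=
  [&& p != [::], uniq (unzip1 p), uniq (unzip2 p)
    & cycle (fun a b => joins a.2 a.1 b.1) p].

Definition cycle_edge_set (G : graph) (X : {set edge G}) : Prop :=
  exists2 p : seq (vertex G * edge G), graph_cycle p & X = [set:: unzip2 p].

(* The cycle matroid M(G) is the matroid on the edges of G whose circuits are
   the edge sets of the cycles of G; M is graphic when it is isomorphic to some
   M(G). *)
Definition graphic (E : finType) (M : matroid E) : Prop :=
  exists (G : graph) (phi : E -> edge G), bijective phi /\
    forall X : {set E}, circuit M X <-> cycle_edge_set (phi @: X).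

(* s lists the elements of X in the order in which they are met when going
   round the polygon. A reversible cyclic ordering is the class of such an s up
   to rotation and reflection; it is represented here by any of its members,
   adjacency being the same for all of them ([adjacent_rot], [adjacent_rev]). *)
Definition arrangement (E : finType) (X : {set E}) (s : seq E) : Prop :=
  uniq s /\ s =i X.

(* Meaningful for distinct x and y. *)
Definition adjacent (E : finType) (s : seq E) (x y : E) : bool :=
  (next s x == y) || (next s y == x).

Lemma adjacent_rot (E : finType) (s : seq E) (n : nat) (x y : E) :
  uniq s -> adjacent (rot n s) x y = adjacent s x y.
Proof. by move=> us; rewrite /adjacent !next_rot. Qed.

Lemma adjacent_rev (E : finType) (s : seq E) (x y : E) :
  uniq s -> adjacent (rev s) x y = adjacent s x y.
Proof.
move=> us; rewrite /adjacent !next_rev // orbC.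
by congr (_ || _); rewrite eq_sym; apply/eqP/eqP => [->|<-];
  rewrite ?next_prev ?prev_next.
Qed.

(* Only the values of O on the circuits of M matter. *)
Definition ordering (E : finType) (M : matroid E) (O : {set E} -> seq E) : Prop :=
  forall C : {set E}, circuit M C -> arrangement C (O C).

Definition consistent (E : finType) (M : matroid E) (O : {set E} -> seq E) : Prop :=
  forall e f : E, e != f ->
  forall C C' : {set E}, circuit M C -> circuit M C' ->
    [set e; f] \subset C :&: C' ->
    adjacent (O C) e f -> adjacent (O C') e f.

Definition orderable (E : finType) (M : matroid E) : Prop :=
  exists O : {set E} -> seq E, ordering M O /\ consistent M O.

(* Main.v *)
Require Import Defs.
From mathcomp Require Import all_boot.

(* Two edges of a cycle of a graph are consecutive in that cycle exactly when
   they have a common end, a condition that does not mention the cycle. So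
   listing the edges of each cycle in the order in which they are traversed
   gives a consistent ordering. *)

Lemma uniq_map_inj_in {T U : eqType} {h : T -> U} {s : seq T} :
  uniq (map h s) -> {in s &, injective h}.
Proof.
move=> us x y xs ys exy; have x0 := x.
rewrite -(nth_index x0 xs) -(nth_index x0 ys); congr nth.
apply/eqP; rewrite -(nth_uniq (h x0) _ _ us) ?size_map ?index_mem //.
by rewrite !(nth_map x0) ?index_mem // !nth_index // exy.
Qed.

(** Injectivity of [h] on the entries of [s] suffices. This covers the projection of a cycle to its
    edges, which need not be injective on all vertex-edge pairs. *)
Lemma next_map_in {T U : eqType} (h : T -> U) (s : seq T) (x : T) :
  uniq (map h s) -> x \in s -> next (map h s) (h x) = h (next s x).
Proof.
move=> us xs; have hI := uniq_map_inj_in us.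
(* The default [head x s] is the wrap-around: the index of the last entry falls just past the end of
   [behead s]. *)
have -> : next s x = nth (head x s) (behead s) (index x s).
  by rewrite next_nth xs; case: s xs {us hI}.
rewrite next_nth map_f //.
have -> : index (h x) (map h s) = index x s.
  rewrite -{1}(nth_index x xs) -(nth_map x (h x)) ?index_mem //.
  by rewrite index_uniq ?size_map ?index_mem.
case: s xs {us hI} => //= y s _; set i := (if _ then _ else _).
have [lt_i|le_i] := ltnP i (size s); first by rewrite (nth_map y).
by rewrite !nth_default ?size_map.
Qed.

Definition incident {G : graph} (e : edge G) (v : vertex G) : bool :=
  ((ends e).1 == v) || ((ends e).2 == v).

Lemma joins_incident {G : graph} (e : edge G) (u w v : vertex G) :
  joins e u w -> incident e v = (u == v) || (w == v).
Proof. by rewrite /joins /incident => /orP[]/eqP-> //=; rewrite orbC. Qed.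

Definition share_end {G : graph} (e f : edge G) : bool :=
  [exists v, incident e v && incident f v].

(** An entry [a] carries an edge with ends [a.1] and [(next p a).1]. The vertices of the cycle are
    distinct, so a common end of two different edges is where one finishes and the other starts. *)
Lemma adjacent_share_end {G : graph} (p : seq (vertex G * edge G))
    (e f : edge G) :
  graph_cycle p -> e \in unzip2 p -> f \in unzip2 p -> e != f ->
  adjacent (unzip2 p) e f = share_end e f.
Proof.
case/and4P=> _ u1 u2 cyc /mapP[a ap ->] /mapP[b bp ->] neq.
have up : uniq p by apply: map_uniq u1.
have [I1 I2] := (uniq_map_inj_in u1, uniq_map_inj_in u2).
rewrite /adjacent !next_map_in //.
(* An entry of [p] is determined by its vertex as well as by its edge. *)
have nE x y : x \in p -> y \in p ->
    ((next p x).2 == y.2) = ((next p x).1 == y.1).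
  move=> xp yp; have np : next p x \in p by rewrite mem_next.
  by apply/eqP/eqP => [/(I2 _ _ np yp)->|/(I1 _ _ np yp)->].
have iE x v : x \in p -> incident x.2 v = (x.1 == v) || ((next p x).1 == v).
  by move=> xp; apply: joins_incident; apply: next_cycle cyc xp.
rewrite !nE //; apply/orP/existsP => [[]/eqP E|[v]].
- by exists b.1; rewrite !iE // E eqxx orbT.
- by exists a.1; rewrite !iE // E eqxx orbT.
have ab : a != b by apply: contraNneq neq => ->.
(* A common start or a common finish forces [a = b]; the two mixed cases are the two disjuncts of
   adjacency. *)
rewrite !iE // => /andP[/orP[]/eqP<- /orP[]/eqP E].
- by case/eqP: ab; apply: I1.
- by right; apply/eqP.
- by left; rewrite E.
case/eqP: ab; rewrite -[a](prev_next up) -[b](prev_next up); congr prev.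
by apply: I1; rewrite ?mem_next.
Qed.

Theorem proposition1 (E : finType) (M : matroid E) (hM : graphic M) : orderable M.
Proof.
case: hM => G [phi [[g phiK gK] circP]].
(* The implication sits under the existential so that every set has a witness and finite choice
   gives a total [F]. *)
have exF C : exists p : seq (vertex G * edge G),
    circuit M C -> graph_cycle p /\ phi @: C = [set:: unzip2 p].
  case: (boolP (circuit M C)) => [|_]; last by exists [::].
  by case/circP=> p; exists p.
have [F FP] := fin_all_exists exF.
have phiI := can_inj phiK; have gI := can_inj gK.
have memF C x : circuit M C -> (phi x \in unzip2 (F C)) = (x \in C).
  by case/FP=> _ eqC; rewrite -(mem_imset _ _ phiI) eqC inE.
have adjE C x y : circuit M C -> adjacent (map g (unzip2 (F C))) x y
    = adjacent (unzip2 (F C)) (phi x) (phi y).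
  case/FP=> /and4P[_ _ u2 _] _; rewrite -{1}[x]phiK -{1}[y]phiK /adjacent.
  by rewrite !(next_map gI) // -!(inj_eq gI).
exists (fun C => map g (unzip2 (F C))); split=> [C cC|e f nef C C' cC cC'].
  have [/and4P[_ _ u2 _] _] := FP C cC.
  split; first by rewrite map_inj_uniq.
  by move=> x; rewrite -[x in LHS]phiK mem_map // memF.
rewrite subUset !sub1set !inE => /andP[/andP[eC eC'] /andP[fC fC']].
have [pC _] := FP C cC; have [pC' _] := FP C' cC'.
(* Both adjacencies become [share_end (phi e) (phi f)]. *)
by rewrite !adjE // !adjacent_share_end ?memF ?(inj_eq phiI).
Qed.
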